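(* Let $L=uI+J\subset R=K[x_1,\ldots,x_n]$ be a monomial ideal, where $I,J\subset R$ are monomial ideals and $u\in R$ is a monomial, such that $\mathrm{supp}(u)\cap(\mathrm{supp}(I)\cup\mathrm{supp}(J))=\emptyset$. Then, for all $t\geq 1$, if $\mathfrak{m}\in \mathrm{Ass}(R/(L^t,u^t))$, then at least one of the following statements holds: (i) $\mathfrak{m}\in \mathrm{Ass}(R/L^t)$; (ii) $u=x_j$ for some $1\leq j\leq n$ and $\mathfrak{m}\setminus\{x_j\}\in \mathrm{Ass}(R/(I+J)^t)$.
   Context: Here $K$ is a field, $R=K[x_1,\ldots,x_n]$ is a polynomial ring and $\mathfrak{m}=(x_1,\ldots,x_n)$. For an ideal $Q$ of $R$ and $f\in R$, $(Q,f)$ denotes the ideal $Q+fR$, and $\mathrm{Ass}(R/Q)$ is the set of associated primes of $Q$, i.e. the prime ideals of the form $(Q:f)=\{r\in R\mid rf\in Q\}$ with $f\in R$. For a monomial $u$, $\mathrm{supp}(u)$ is the set of variables dividing $u$ (with $\mathrm{supp}(1)=\emptyset$); for a monomial ideal $I$ with unique minimal set of monomial generators $\mathcal{G}(I)$, $\mathrm{supp}(I)=\bigcup_{v\in\mathcal{G}(I)}\mathrm{supp}(v)$. The notation $\mathfrak{m}\setminus\{x_j\}$ denotes the ideal of $R$ generated by all the variables $x_1,\ldots,x_n$ except $x_j$.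
   Formalization: In (ii), ''u = x_j'' is replaced by ''u = x_j^a for some a ≥ 1''; as written the claim fails, e.g. for I = J = (y), u = x^2, t = 1 in K[x,y]. For squarefree u the original wording follows. *)

(* Defs.v *)
From HB Require Import structures.
From mathcomp Require Import all_boot all_order all_algebra.
From mathcomp Require Import boolp classical_sets.
From mathcomp Require Import mpoly.

Set Implicit Arguments.
Unset Strict Implicit.
Unset Printing Implicit Defensive.

Import GRing.Theory.

Local Open Scope classical_set_scope.
Local Open Scope ring_scope.

(* Ideals are classical sets, because MathComp's own ideals (ring_quotient)
   are boolean predicates and are proper by definition. *)

Section Ideals.
Variable R : comNzRingType.
Implicit Types (A B P Q S : set R) (f : R).

Definition is_ideal A : Prop :=
  [/\ A 0, (forall f g, A f -> A g -> A (f + g)) &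
      (forall r f, A f -> A (r * f))].

Definition ideal_gen S : set R := smallest is_ideal S.

Definition ideal_add A B : set R := [set f + g | f in A & g in B].

Definition ideal_mul A B : set R := ideal_gen [set f * g | f in A & g in B].

Definition ideal_exp A (t : nat) : set R := iter t (ideal_mul A) setT.

(* f A = { f g : g in A } *)
Definition ideal_scale f A : set R := [set f * g | g in A].

(* (Q, f) = Q + f R *)
Definition ideal_adjoin Q f : set R := ideal_add Q (ideal_scale f setT).

(* (Q : f) *)
Definition ideal_colon Q f : set R := [set r | Q (r * f)].

Definition is_prime_ideal P : Prop :=
  [/\ is_ideal P, ~ P 1 & forall f g, P (f * g) -> P f \/ P g].

(* Ass(R/Q) *)
Definition Ass Q : set (set R) :=
  [set P | is_prime_ideal P /\ exists f, P = ideal_colon Q f].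

Lemma ideal_gen_ideal S : is_ideal (ideal_gen S).
Proof.
split.
- by move=> A [[]].
- move=> f g hf hg A hA; have [[_ D _] _] := hA.
  by apply: D; [exact: hf | exact: hg].
- move=> r f hf A hA; have [[_ _ M] _] := hA; by apply: M; exact: hf.
Qed.

Lemma sub_ideal_gen S : S `<=` ideal_gen S.
Proof. exact: sub_smallest. Qed.

Lemma ideal_gen_sub S A : is_ideal A -> S `<=` A -> ideal_gen S `<=` A.
Proof. exact: smallest_sub. Qed.

End Ideals.

Section Monomials.
Variables (K : fieldType) (n : nat).
Implicit Types (m u v : 'X_{1..n}) (I : set {mpoly K[n]}) (G : set 'X_{1..n}).

(* A monomial is represented by its exponent vector u; as an element of R it
   is 'X_[u].  A variable is represented by its index. *)

Definition mon_supp u : set 'I_n := [set i | (0 < u i)%N].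

Definition mon_ideal G : set {mpoly K[n]} :=
  ideal_gen [set 'X_[v] | v in G].

Definition is_monomial_ideal I : Prop := exists G, I = mon_ideal G.

Definition is_min_gens I G : Prop :=
  I = mon_ideal G /\ forall G', G' `<=` G -> I = mon_ideal G' -> G' = G.

(* G(I); existence and uniqueness for a monomial ideal I are
   [min_gens_exists] and [min_gens_unique]. *)
Definition min_gens I : set 'X_{1..n} := xget set0 (is_min_gens I).

Definition ideal_supp I : set 'I_n :=
  \bigcup_(v in min_gens I) mon_supp v.

(* the ideal generated by the variables whose indices lie in V *)
Definition vars_ideal (V : set 'I_n) : set {mpoly K[n]} :=
  ideal_gen [set 'X_i | i in V].

Definition max_ideal : set {mpoly K[n]} := vars_ideal setT.

(* the ideal written m \ {x_j} *)
Definition max_ideal_minus (j : 'I_n) : set {mpoly K[n]} :=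
  vars_ideal [set i | i != j].

Lemma mem_mon_ideal G u :
  mon_ideal G 'X_[u] -> exists2 v, G v & (v <= u)%MM.
Proof.
pose A : set {mpoly K[n]} :=
  [set f | forall m, m \in msupp f -> exists2 v, G v & (v <= m)%MM].
have idA : is_ideal A.
  split.
  - by move=> m; rewrite msupp0.
  - move=> f g hf hg m /msuppD_le; rewrite mem_cat => /orP[];
      [exact: hf | exact: hg].
  - move=> r f hf m /msuppM_le /allpairsP[[m1 m2] /= [_ h2 ->]].
    have [v Gv vm] := hf _ h2; exists v => //.
    by apply: (lepm_trans vm); rewrite addmC lem_addr.
move=> hu; have sGA : mon_ideal G `<=` A.
  apply: ideal_gen_sub idA _ => _ [v Gv <-] m; rewrite msuppX inE => /eqP ->.
  by exists v => //; exact: lepm_refl.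
by apply: (sGA _ hu); rewrite msuppX inE.
Qed.

Lemma mon_ideal_mem G v u : G v -> (v <= u)%MM -> mon_ideal G 'X_[u].
Proof.
move=> Gv vu; rewrite -(submK vu) mpolyXD.
have [_ _ M] := ideal_gen_ideal [set ('X_[w] : {mpoly K[n]}) | w in G].
by apply: M; apply: sub_ideal_gen; exists v.
Qed.

Lemma mon_ideal_sub G G' :
  (forall v, G v -> exists2 w, G' w & (w <= v)%MM) ->
  mon_ideal G `<=` mon_ideal G'.
Proof.
move=> h; apply: ideal_gen_sub; first exact: ideal_gen_ideal.
by move=> _ [v /h[w Gw wv] <-]; apply: mon_ideal_mem Gw wv.
Qed.

Lemma min_mnm_below G v : G v ->
  exists2 w, (w <= v)%MM &
    G w /\ forall w', G w' -> (w' <= w)%MM -> w' = w.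
Proof.
elim: {v}(mdeg v).+1 {-2}v (ltnSn (mdeg v)) => // k IH v; rewrite ltnS => kv Gv.
have [hmin|/existsNP[w /not_implyP[Gw /not_implyP[wv neq]]]] :=
  pselect (forall w', G w' -> (w' <= v)%MM -> w' = v).
  by exists v => //; exact: lepm_refl.
have lt : (mdeg w < mdeg v)%N.
  rewrite -(submK wv) mdegD -{1}[mdeg w]add0n ltn_add2r lt0n mdeg_eq0.
  by apply: contra_notN neq => /eqP e; rewrite -(submK wv) e add0m.
have [w' w'w h] := IH w (leq_trans lt kv) Gw.
by exists w' => //; apply: lepm_trans w'w wv.
Qed.

Lemma min_gens_exists I : is_monomial_ideal I -> exists G, is_min_gens I G.
Proof.
move=> [G0 ->].
pose G : set 'X_{1..n} :=
  [set v | G0 v /\ forall w, G0 w -> (w <= v)%MM -> w = v].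
have E : mon_ideal G0 = mon_ideal G.
  apply/seteqP; split; apply: mon_ideal_sub => v.
    by move=> /min_mnm_below[w wv h]; exists w.
  by case=> Gv _; exists v => //; exact: lepm_refl.
exists G; split=> // G' sub E'; apply/seteqP; split=> // v Gv.
have : mon_ideal G' 'X_[v].
  rewrite -E'; have [G0v _] := Gv; apply: (mon_ideal_mem G0v); exact: lepm_refl.
move=> /mem_mon_ideal[w G'w wv]; have [_ h] := Gv.
by have [G0w _] := sub _ G'w; rewrite -(h _ G0w wv).
Qed.

Lemma is_min_gensP I G : is_min_gens I G ->
  G = [set v | I 'X_[v] /\ forall w, I 'X_[w] -> (w <= v)%MM -> w = v].
Proof.
case=> -> hmin; have GI v : G v -> mon_ideal G 'X_[v].
  by move=> Gv; apply: (mon_ideal_mem Gv); exact: lepm_refl.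
pose G' : set 'X_{1..n} :=
  [set v | G v /\ forall w, G w -> (w <= v)%MM -> w = v].
have E : G' = G.
  apply: hmin; first by move=> v [].
  apply/seteqP; split; apply: mon_ideal_sub => v.
    by move=> /min_mnm_below[w wv h]; exists w.
  by case=> Gv _; exists v => //; exact: lepm_refl.
apply/seteqP; split=> v.
  move=> Gv; split; first exact: GI.
  move=> w /mem_mon_ideal[w' Gw' w'w] wv; move: (Gv); rewrite -E => -[_ h].
  have e := h _ Gw' (lepm_trans w'w wv); rewrite {}e in w'w.
  by apply/mnmP=> i; apply/eqP; rewrite eqn_leq;
     apply/andP; split; [exact: (mnm_lepP wv)|exact: (mnm_lepP w'w)].
by case=> /mem_mon_ideal[w Gw wv] /(_ w (GI _ Gw) wv) <-.
Qed.

Lemma min_gens_unique I G G' :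
  is_min_gens I G -> is_min_gens I G' -> G = G'.
Proof. by move=> /is_min_gensP -> /is_min_gensP ->. Qed.

End Monomials.

Arguments max_ideal : clear implicits.
Arguments max_ideal_minus {K n} j.

(* Main.v *)
Require Import Defs.
From HB Require Import structures.
From mathcomp Require Import all_boot all_order all_algebra.
From mathcomp Require Import boolp classical_sets.
From mathcomp Require Import mpoly.

(** Everything is decided on exponents. Let [A] and [B] generate [I] and [J],
    with exponents that avoid the variables of [u]. The power [L ^ t] is
    generated by the monomials [u ^ k * c], where [c] is a product of [k]
    generators of [I] and [t - k] generators of [J] ([mon_ideal_exp_mixed]);
    forgetting the factor [u ^ k] leaves generators of [(I + J) ^ t]. Since [u]
    and [c] share no variable, a monomial [w] lies in [L ^ t] iff both [u ^ k]
    and [c] divide [w] for such a pair, and it lies in [Q = (L ^ t, u ^ t)] iff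
    it lies in [L ^ t] or [u ^ t] divides it.

    If the maximal ideal is associated to [Q], some monomial [v] outside [Q]
    satisfies [x_i v \in Q] for every [i] ([Ass_mon_ideal_witness]). Let [k] be
    least such that [u ^ k] does not divide [v]. For a variable [x_i] of [u],
    multiplying [v] by [x_i] changes no divisibility by a [c], so it can enter
    [Q] only by becoming a multiple of [u ^ k]. Two distinct variables of [u]
    doing so would force [u ^ k] to divide [v] already; hence [u] is a power of
    one variable [x_j] ([mnm_pure_power]). For [i != j], multiplying by [x_i]
    changes no divisibility by a power of [u], so [x_i v] is in [L ^ t].

    The same [v] now serves in both alternatives, through
    [Ass_mon_ideal_intro]. If [v] is in [(I + J) ^ t], some [c] with [l]
    factors from [I] divides [v]; should [x_j v] be in [Q] because of [u ^ t],
    then [u ^ l] divides it too as [l <= t], so [x_j v] is in [L ^ t], and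
    [(L ^ t : v)] is the maximal ideal. If [v] is not in [(I + J) ^ t], then no
    [x_j ^ b v] is either, while [x_i v] is for [i != j], so
    [((I + J) ^ t : v)] is generated by the variables other than [x_j]. *)

Set Implicit Arguments.
Unset Strict Implicit.
Unset Printing Implicit Defensive.

Import GRing.Theory.

Local Open Scope classical_set_scope.
Local Open Scope ring_scope.

(** * Sums, multiples and products of generated ideals *)

Section IdealArithmetic.
Variable R : comNzRingType.
Implicit Types (S T : set R) (f : R).

Lemma ideal_gen_mono S T : S `<=` T -> ideal_gen S `<=` ideal_gen T.
Proof.
move=> ST; apply: ideal_gen_sub; first exact: ideal_gen_ideal.
exact: subset_trans ST (@sub_ideal_gen _ _).
Qed.

Lemma setT_gen1 : [set: R] = ideal_gen [set 1].
Proof.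
apply/seteqP; split=> // r _; have [_ _ M] := ideal_gen_ideal [set (1 : R)].
by rewrite -[r]mulr1; apply: M; apply: sub_ideal_gen.
Qed.

Lemma ideal_add_gen S T :
  ideal_add (ideal_gen S) (ideal_gen T) = ideal_gen (S `|` T).
Proof.
have [S0 SD SM] := ideal_gen_ideal S; have [T0 TD TM] := ideal_gen_ideal T.
have [_ UD _] := ideal_gen_ideal (S `|` T).
apply/seteqP; split.
  move=> _ [f Sf [g Tg <-]]; apply: UD.
    by apply: ideal_gen_mono Sf; left.
  by apply: ideal_gen_mono Tg; right.
apply: ideal_gen_sub.
  split.
  - by exists 0 => //; exists 0 => //; rewrite addr0.
  - move=> _ _ [f1 ? [g1 ? <-]] [f2 ? [g2 ? <-]].
    exists (f1 + f2); first exact: SD.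
    by exists (g1 + g2); [exact: TD | rewrite addrACA].
  - move=> r _ [f ? [g ? <-]]; exists (r * f); first exact: SM.
    by exists (r * g); [exact: TM | rewrite mulrDr].
move=> f [Sf|Tf].
  by exists f; [exact: sub_ideal_gen | exists 0 => //; rewrite addr0].
by exists 0 => //; exists f; [exact: sub_ideal_gen | rewrite add0r].
Qed.

Lemma ideal_scale_gen f S :
  ideal_scale f (ideal_gen S) = ideal_gen [set f * g | g in S].
Proof.
have [S0 SD SM] := ideal_gen_ideal S.
have [G0 GD GM] := ideal_gen_ideal [set f * g | g in S].
apply/seteqP; split.
  move=> _ [g Sg <-].
  suff : ideal_gen S `<=` [set h | ideal_gen [set f * k | k in S] (f * h)].
    by apply.
  apply: ideal_gen_sub.
    split=> /=.
    - by rewrite mulr0.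
    - by move=> h k Hh Hk; rewrite mulrDr; apply: GD.
    - by move=> r h Hh; rewrite mulrCA; apply: GM.
  by move=> h Sh; apply: sub_ideal_gen; exists h.
apply: ideal_gen_sub.
  split.
  - by exists 0 => //; rewrite mulr0.
  - move=> _ _ [g ? <-] [h ? <-]; exists (g + h); first exact: SD.
    by rewrite mulrDr.
  - by move=> r _ [g ? <-]; exists (r * g); [exact: SM | rewrite mulrCA].
by move=> _ [g Sg <-]; exists g => //; apply: sub_ideal_gen.
Qed.

(** Fixing one factor, the multiplicands that land in the product ideal form
    an ideal, so membership propagates from generators to generated elements
    one factor at a time. *)
Lemma ideal_mul_gen S T :
  ideal_mul (ideal_gen S) (ideal_gen T) =
  ideal_gen [set f * g | f in S & g in T].
Proof.
set U := [set f * g | f in S & g in T].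
apply/seteqP; split; last first.
  apply: ideal_gen_mono => _ [f Sf [g Tg <-]].
  by exists f; [|exists g]; rewrite //; apply: sub_ideal_gen.
apply: ideal_gen_sub; first exact: ideal_gen_ideal.
have [U0 UD UM] := ideal_gen_ideal U.
have colonE h : is_ideal [set k | ideal_gen U (h * k)].
  split=> /=.
  - by rewrite mulr0.
  - by move=> k l Hk Hl; rewrite mulrDr; apply: UD.
  - by move=> r k Hk; rewrite mulrCA; apply: UM.
move=> _ [f Sf [g Tg <-]].
suff sub : ideal_gen S `<=` [set h | ideal_gen U (g * h)].
  by rewrite mulrC; apply: sub.
apply: ideal_gen_sub => // h Sh /=; rewrite mulrC.
suff sub : ideal_gen T `<=` [set k | ideal_gen U (h * k)] by apply: sub.
apply: ideal_gen_sub => // k Tk; apply: sub_ideal_gen.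
by exists h => //; exists k.
Qed.

End IdealArithmetic.

(** * Monomial ideals and their associated primes *)

Section MonomialIdeals.
Variables (K : fieldType) (n : nat).
Implicit Types (G H : set 'X_{1..n}) (V : set 'I_n) (m v w : 'X_{1..n}).
Implicit Types (f g : {mpoly K[n]}).
Local Notation mideal := (@mon_ideal K n).

Lemma mon_idealXP G m :
  mideal G 'X_[m] <-> exists2 v, G v & (v <= m)%MM.
Proof.
split; first exact: mem_mon_ideal.
by move=> [v Gv vm]; apply: mon_ideal_mem Gv vm.
Qed.

Lemma mon_idealXD G m w : mideal G 'X_[m] -> mideal G 'X_[m + w].
Proof.
move=> /mon_idealXP[v Gv vm]; apply/mon_idealXP; exists v => //.
by apply: lepm_trans vm _; apply: lem_addr.
Qed.

(** Polynomials all of whose monomials lie in [mideal G] form an ideal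
    containing the generators: monomial ideals are graded by exponents. *)
Lemma mon_idealP G f :
  mideal G f <-> forall m, m \in msupp f -> mideal G 'X_[m].
Proof.
have [G0 GD GM] := ideal_gen_ideal [set ('X_[w] : {mpoly K[n]}) | w in G].
split; last first.
  move=> h; rewrite [f]mpolyE big_seq; elim/big_ind: _ => // m /h Gm.
  by rewrite -mul_mpolyC; apply: GM.
suff sub : mideal G `<=`
    [set f | forall m, m \in msupp f -> mideal G 'X_[m]] by apply: sub.
apply: ideal_gen_sub.
  split=> /=.
  - by move=> m; rewrite msupp0.
  - move=> f1 f2 h1 h2 m /msuppD_le; rewrite mem_cat => /orP[];
      [exact: h1 | exact: h2].
  - move=> r f1 h1 m /msuppM_le /allpairsP[[m1 m2] /= [_ /h1 h2 ->]].
    by rewrite addmC; apply: mon_idealXD.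
move=> _ [v Gv <-] m; rewrite msuppX inE => /eqP ->.
by apply: sub_ideal_gen; exists v.
Qed.

Lemma mon_idealMX G f w :
  mideal G (f * 'X_[w]) <->
  forall m, m \in msupp f -> mideal G 'X_[w + m].
Proof.
rewrite mon_idealP; split=> h m.
  move=> fm; apply: h; rewrite (perm_mem (msuppMX f w)).
  by apply/mapP; exists m.
by rewrite (perm_mem (msuppMX f w)) => /mapP[m' /h ? ->].
Qed.

Lemma mon_ideal_add G H :
  ideal_add (mideal G) (mideal H) = mideal (G `|` H).
Proof. by rewrite /mon_ideal ideal_add_gen image_setU. Qed.

Lemma mon_ideal_scale u G :
  ideal_scale 'X_[u] (mideal G) = mideal [set (u + v)%MM | v in G].
Proof.
rewrite /mon_ideal ideal_scale_gen; congr ideal_gen.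
apply/seteqP; split=> _ [_ [v Gv <-] <-].
  by exists (u + v)%MM; [exists v | rewrite mpolyXD].
by exists 'X_[v]; [exists v | rewrite mpolyXD].
Qed.

Lemma mon_ideal_mul G H :
  ideal_mul (mideal G) (mideal H) = mideal [set (v + w)%MM | v in G & w in H].
Proof.
rewrite /mon_ideal ideal_mul_gen; congr ideal_gen; apply/seteqP; split.
  move=> _ [_ [v Gv <-] [_ [w Hw <-] <-]].
  by exists (v + w)%MM; [exists v => //; exists w | rewrite mpolyXD].
move=> _ [_ [v Gv [w Hw <-]] <-]; rewrite mpolyXD.
by exists 'X_[v]; [exists v | exists 'X_[w] => //; exists w].
Qed.

Lemma mon_ideal_setT : [set: {mpoly K[n]}] = mideal [set 0%MM].
Proof. by rewrite setT_gen1 /mon_ideal image_set1 mpolyX0. Qed.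

Lemma mon_ideal_adjoin G w :
  ideal_adjoin (mideal G) 'X_[w] = mideal (G `|` [set w]).
Proof.
rewrite /ideal_adjoin mon_ideal_setT mon_ideal_scale mon_ideal_add.
by rewrite image_set1 addm0.
Qed.

Lemma vars_idealE V : vars_ideal V = mideal [set U_(i)%MM | i in V].
Proof. by rewrite /vars_ideal /mon_ideal image_comp. Qed.

Lemma vars_idealXP V m :
  @vars_ideal K n V 'X_[m] <-> exists2 i, V i & (0 < m i)%N.
Proof.
rewrite vars_idealE mon_idealXP; split.
  by move=> [_ [i Vi <-]] /mnm_lepP/(_ i); rewrite mnm1E eqxx; exists i.
move=> [i Vi mi]; exists U_(i)%MM; first by exists i.
by rewrite lep1mP -lt0n.
Qed.

(** Substituting 0 for the variables of [V] is a ring morphism with values in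
    a domain; it fixes every polynomial modulo [vars_ideal V], so its kernel is
    exactly that ideal. *)
Lemma vars_ideal_prime V : is_prime_ideal (@vars_ideal K n V).
Proof.
have idV : is_ideal (@vars_ideal K n V) by apply: ideal_gen_ideal.
have [V0 VD VM] := idV.
pose h i : {mpoly K[n]} := if `[< V i >] then 0 else 'X_i.
pose phi : {rmorphism {mpoly K[n]} -> {mpoly K[n]}} := mmap (@mpolyC n K) h.
have phi_mod f : vars_ideal V (f - phi f).
  rewrite [f]mpolyE rmorph_sum -sumrB; elim/big_ind: _ => // m _.
  rewrite -mul_mpolyC rmorphM /= mmapC -mulrBr; apply: VM.
  rewrite mmapX; have [mV|mV] := pselect (exists2 i, V i & (0 < m i)%N).
    have [i Vi mi] := mV; rewrite /mmap1 (bigD1 i) //= /h asboolT //.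
    by rewrite expr0n eqn0Ngt mi mul0r subr0; apply/vars_idealXP.
  rewrite [X in X - _]mpolyXE_id /mmap1 (eq_bigr (fun i => h i ^+ m i)).
    by rewrite subrr.
  move=> i _; rewrite /h; case: asboolP => // Vi.
  by have [->|mi] := posnP (m i); [rewrite !expr0 | case: mV; exists i].
have phi_ker f : vars_ideal V f <-> phi f = 0.
  split; last by move=> f0; rewrite -[f]subr0 -f0; apply: phi_mod.
  suff sub : vars_ideal V `<=` [set f | phi f = 0] by apply: sub.
  apply: ideal_gen_sub.
    split=> /=; first by rewrite rmorph0.
      by move=> f1 f2 h1 h2; rewrite rmorphD /= h1 h2 addr0.
    by move=> r f1 h1; rewrite rmorphM /= h1 mulr0.
  by move=> _ [i Vi <-] /=; rewrite mmapX mmap1U /h asboolT.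
split=> //; first by rewrite phi_ker rmorph1; apply/eqP/oner_neq0.
move=> f g; rewrite !phi_ker rmorphM => /eqP.
by rewrite mulf_eq0 => /orP[]/eqP ->; [left | right].
Qed.

(** When [f] realizes the prime as a colon ideal, [f] is outside [mideal G],
    hence so is one of its monomials; that monomial inherits the other
    property of [f] by gradedness. *)
Lemma Ass_mon_ideal_witness G V :
  Ass (mideal G) (vars_ideal V) ->
  exists2 v, ~ mideal G 'X_[v] & forall i, V i -> mideal G 'X_[v + U_(i)].
Proof.
move=> [[_ V1 _] [f fE]].
have /existsNP[v /not_implyP[fv Gv]] :
    ~ forall m, m \in msupp f -> mideal G 'X_[m].
  move=> /mon_idealP Gf; apply: V1.
  by rewrite fE /ideal_colon /= mul1r.
exists v => // i Vi; have : vars_ideal V ('X_i : {mpoly K[n]}).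
  by apply: sub_ideal_gen; exists i.
by rewrite fE /ideal_colon /= mulrC mon_idealMX => /(_ v fv); rewrite addmC.
Qed.

(** The two hypotheses describe the monomials of the colon ideal by ['X_[v]];
    by gradedness they determine it. *)
Lemma Ass_mon_ideal_intro G V v :
    (forall i, V i -> mideal G 'X_[v + U_(i)]) ->
    (forall m, (forall i, V i -> m i = 0%N) -> ~ mideal G 'X_[v + m]) ->
  Ass (mideal G) (vars_ideal V).
Proof.
move=> Vin Vout; split; first exact: vars_ideal_prime.
exists 'X_[v]; apply/seteqP; split=> f.
  rewrite /ideal_colon /= vars_idealE mon_idealP mon_idealMX => + m fm.
  move=> /(_ m fm); rewrite -vars_idealE vars_idealXP => -[i Vi mi].
  have /submK <- : (U_(i) <= m)%MM by rewrite lep1mP -lt0n.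
  by rewrite [(_ + U_(i))%MM]addmC addmA; apply: mon_idealXD; apply: Vin.
rewrite /ideal_colon /= mon_idealMX => fv; rewrite vars_idealE mon_idealP.
move=> m /fv Gm; rewrite -vars_idealE vars_idealXP.
apply: contrapT => mV; apply: Vout Gm => i Vi.
by have [//|mi] := posnP (m i); case: mV; exists i.
Qed.

End MonomialIdeals.

(** * Powers of a sum of two monomial ideals *)

Section MixedSums.
Variables (K : fieldType) (n : nat).
Implicit Types (A B : set 'X_{1..n}) (u c : 'X_{1..n}).

(** [mixed_sum A B t k c]: [c] is the exponent of a product of [t] generators,
    [k] of them from [A] and [t - k] from [B]. *)
Inductive mixed_sum A B : nat -> nat -> 'X_{1..n} -> Prop :=
| mixed_sum0 : mixed_sum A B 0 0 0%MM
| mixed_sumA t k a c of A a & mixed_sum A B t k c :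
    mixed_sum A B t.+1 k.+1 (a + c)%MM
| mixed_sumB t k b c of B b & mixed_sum A B t k c :
    mixed_sum A B t.+1 k (b + c)%MM.

Lemma mixed_sum_le A B t k c : mixed_sum A B t k c -> (k <= t)%N.
Proof. by elim=> // ? ? ? ? _ _; apply: leqW. Qed.

Lemma mixed_sum_eq0 A B i :
    (forall v, (A `|` B) v -> v i = 0%N) ->
  forall t k c, mixed_sum A B t k c -> c i = 0%N.
Proof.
move=> AB0 t k c; elim=> [|? ? a ? Aa _ IH|? ? b ? Bb _ IH].
- by rewrite mnm0E.
- by rewrite mnmDE IH AB0 //; left.
- by rewrite mnmDE IH AB0 //; right.
Qed.

(** Taking [u = 0] gives the powers of the unscaled sum, with the same mixed
    sums; this is what lets [L ^ t] and [(I + J) ^ t] be compared. *)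
Lemma mon_ideal_exp_mixed A B u t :
  ideal_exp (@mon_ideal K n ([set (u + a)%MM | a in A] `|` B)) t =
  mon_ideal [set v | exists k c,
    mixed_sum A B t k c /\ v = (u *+ k + c)%MM].
Proof.
have addmCA (m1 m2 m3 : 'X_{1..n}) : (m1 + (m2 + m3) = m2 + (m1 + m3))%MM.
  by rewrite !addmA [(m1 + m2)%MM]addmC.
have add0 c : (u *+ 0 + c)%MM = c by rewrite mulm0n add0m.
elim: t => [|t IH].
  rewrite /ideal_exp /= mon_ideal_setT; congr mon_ideal.
  apply/seteqP; split=> v.
    by move=> ->; exists 0%N, 0%MM; rewrite add0; split=> //; apply: mixed_sum0.
  move=> [k [c [Mc ->]]]; inversion Mc; exact: add0.
rewrite /ideal_exp iterS -/(ideal_exp _ t) IH mon_ideal_mul; congr mon_ideal.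
apply/seteqP; split.
  move=> _ [v ABv [_ [k [c [Mc ->]]] <-]]; case: ABv => [[a Aa <-]|Bv].
    exists k.+1, (a + c)%MM; split; first exact: mixed_sumA.
    by rewrite mulmS -!addmA; congr mnm_add; rewrite addmCA.
  exists k, (v + c)%MM; split; first exact: mixed_sumB.
  by rewrite addmCA.
move=> _ [k [c [Mc ->]]]; inversion Mc as [|t' k' a c' Aa Mc'|t' k' b c' Bb Mc'].
  exists (u + a)%MM; first by left; exists a.
  exists (u *+ k' + c')%MM; first by exists k', c'.
  by rewrite mulmS -!addmA; congr mnm_add; rewrite addmCA.
exists b; first by right.
exists (u *+ k + c')%MM; first by exists k, c'.
by rewrite addmCA.
Qed.

End MixedSums.

(** * Divisibility of monomials *)

Section Divisibility.
Variables (K : fieldType) (n : nat).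

Lemma mon_ideal_min_gens (I : set {mpoly K[n]}) :
  is_monomial_ideal I -> I = mon_ideal (min_gens I).
Proof. by move=> /min_gens_exists ex; case: (xgetPex set0 ex). Qed.

Lemma mulm_lel (u : 'X_{1..n}) k l : (k <= l)%N -> (u *+ k <= u *+ l)%MM.
Proof. by move=> kl; apply/mnm_lepP => i; rewrite !mulmnE leq_mul2l kl orbT. Qed.

Lemma lem_add_disjoint (m1 m2 w : 'X_{1..n}) :
    (forall i, (0 < m1 i)%N -> m2 i = 0%N) ->
  (m1 + m2 <= w)%MM = (m1 <= w)%MM && (m2 <= w)%MM.
Proof.
move=> dis; apply/idP/andP.
  move=> le; split; apply: lepm_trans le; [exact: lem_addr | exact: lem_addl].
move=> [/mnm_lepP le1 /mnm_lepP le2]; apply/mnm_lepP => i; rewrite mnmDE.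
by have [->|/dis ->] := posnP (m1 i); rewrite ?addn0 ?add0n.
Qed.

(** Multiplying by a variable repairs the divisibility by [u *+ k] at that
    variable only. If two distinct variables could each repair it, it would
    fail nowhere. *)
Lemma mnm_pure_power (u w : 'X_{1..n}) k (j : 'I_n) :
    ~~ (u *+ k <= w)%MM ->
    (forall i, (0 < u i)%N -> (u *+ k <= w + U_(i))%MM) ->
    (0 < u j)%N ->
  u = (U_(j) *+ u j)%MM.
Proof.
move=> Nle le uj; apply/mnmP => i; rewrite mulmnE mnm1E.
have [->|ji] := eqVneq j i; first by rewrite mul1n.
rewrite mul0n; apply/eqP; rewrite eqn0Ngt; apply: contra Nle => ui.
apply/mnm_lepP => l.
have [<-|il] := eqVneq i l.
  by move/mnm_lepP: (le j uj) => /(_ i); rewrite mnmDE mnm1E (negPf ji) addn0.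
by move/mnm_lepP: (le i ui) => /(_ l); rewrite mnmDE mnm1E (negPf il) addn0.
Qed.

End Divisibility.

(** * The maximal ideal as an associated prime *)

Theorem proposition3p11 (K : fieldType) (n : nat)
    (I J L : set {mpoly K[n]}) (u : 'X_{1..n})
    (hI : is_monomial_ideal I) (hJ : is_monomial_ideal J)
    (hL : L = ideal_add (ideal_scale 'X_[u] I) J)
    (hsupp : mon_supp u `&` (ideal_supp I `|` ideal_supp J) = set0)
    (t : nat) (ht : (1 <= t)%N) :
  Ass (ideal_adjoin (ideal_exp L t) ('X_[u] ^+ t)) (max_ideal K n) ->
  Ass (ideal_exp L t) (max_ideal K n) \/
  exists (j : 'I_n) (a : nat),
    [/\ (1 <= a)%N, u = (U_(j) *+ a)%MM
      & Ass (ideal_exp (ideal_add I J) t) (max_ideal_minus j)].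
Proof.
have eI := mon_ideal_min_gens hI; have eJ := mon_ideal_min_gens hJ.
set A := min_gens I in eI; set B := min_gens J in eJ.
have AB0 i : (0 < u i)%N -> forall v, (A `|` B) v -> v i = 0%N.
  move=> ui v ABv; have [//|vi] := posnP (v i).
  suff : (mon_supp u `&` (ideal_supp I `|` ideal_supp J)) i by rewrite hsupp.
  by split=> //; case: ABv => ?; [left | right]; exists v.
have dis k c : mixed_sum A B t k c -> forall i, (0 < u i)%N -> c i = 0%N.
  by move=> Mc i ui; apply: (mixed_sum_eq0 (AB0 i ui) Mc).
pose G := [set v | exists k c, mixed_sum A B t k c /\ v = (u *+ k + c)%MM].
have expL : ideal_exp L t = mon_ideal G.
  by rewrite hL eI eJ mon_ideal_scale mon_ideal_add mon_ideal_exp_mixed.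
have memL w : mon_ideal G ('X_[w] : {mpoly K[n]}) <->
    exists k c, [/\ mixed_sum A B t k c, (u *+ k <= w)%MM & (c <= w)%MM].
  have le_split k c : mixed_sum A B t k c ->
      (u *+ k + c <= w)%MM = (u *+ k <= w)%MM && (c <= w)%MM.
    move=> Mc; apply: lem_add_disjoint => i; rewrite mulmnE muln_gt0.
    by case/andP => ui _; apply: dis Mc i ui.
  rewrite mon_idealXP; split.
    by move=> [_ [k [c [Mc ->]]]]; rewrite le_split // => /andP[? ?]; exists k, c.
  move=> [k [c [Mc uk cw]]]; exists (u *+ k + c)%MM; first by exists k, c.
  by rewrite le_split // uk.
pose H := [set v | exists k c, mixed_sum A B t k c /\ v = (0 *+ k + c)%MM].
have expIJ : ideal_exp (ideal_add I J) t = mon_ideal H.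
  rewrite eI eJ mon_ideal_add -mon_ideal_exp_mixed.
  congr (ideal_exp (mon_ideal (_ `|` _)) _).
  by apply/seteqP; split=> [v Av|_ [v Av <-]]; [exists v|]; rewrite ?add0m.
have memIJ w : mon_ideal H ('X_[w] : {mpoly K[n]}) <->
    exists k c, mixed_sum A B t k c /\ (c <= w)%MM.
  have zk k c : (0 *+ k + c)%MM = c :> 'X_{1..n}.
    by apply/mnmP => i; rewrite mnmDE mulmnE mnm0E.
  rewrite mon_idealXP; split.
    by move=> [_ [k [c [Mc ->]]]]; rewrite zk; exists k, c.
  by move=> [k [c [Mc cw]]]; exists c => //; exists k, c.
rewrite expIJ expL mpolyXn mon_ideal_adjoin.
have memQ w : mon_ideal (G `|` [set u *+ t]%MM) ('X_[w] : {mpoly K[n]}) <->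
    mon_ideal G ('X_[w] : {mpoly K[n]}) \/ (u *+ t <= w)%MM.
  rewrite !mon_idealXP; split.
    by move=> [v [Gv|->]] vw; [left; exists v | right].
  move=> [[v Gv vw]|uw]; first by exists v => //; left.
  by exists (u *+ t)%MM => //; right.
move=> /Ass_mon_ideal_witness[v Qv Qvi].
have [NLv Nuv] : ~ mon_ideal G ('X_[v] : {mpoly K[n]}) /\ ~~ (u *+ t <= v)%MM.
  by split; [|apply/negP]; move=> ?; apply: Qv; apply/memQ; [left | right].
have Qvi' i : mon_ideal G ('X_[v + U_(i)] : {mpoly K[n]}) \/
    (u *+ t <= v + U_(i))%MM by apply/memQ; apply: Qvi.
have [j uj] : exists j, (0 < u j)%N.
  apply: contrapT => u0; case/negP: Nuv; apply/mnm_lepP => i.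
  by rewrite mulmnE; have [->//|ui] := posnP (u i); case: u0; exists i.
(* With [k] least, a power of [u] that does not divide [v] is a multiple of
   [u *+ k], whichever generator of the ideal it comes from. *)
have [k Nuk kmin] : exists2 k, ~~ (u *+ k <= v)%MM &
    forall l, ~~ (u *+ l <= v)%MM -> (k <= l)%N.
  have ex : exists k, ~~ (u *+ k <= v)%MM by exists t.
  by case: (ex_minnP ex) => k Nk kmin; exists k.
have uE : u = (U_(j) *+ u j)%MM.
  apply: (mnm_pure_power Nuk _ uj) => i ui.
  have [/memL[l [c [Mc ul cvi]]]|uvi] := Qvi' i; last first.
    by apply: lepm_trans uvi; apply/mulm_lel/kmin.
  apply: lepm_trans ul; apply/mulm_lel/kmin/negP => ulv; apply: NLv.
  apply/memL; exists l, c; split=> //; apply/mnm_lepP => i'.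
  move/mnm_lepP: cvi => /(_ i'); rewrite mnmDE mnm1E.
  by case: eqVneq => [<-|_]; [rewrite (dis _ _ Mc) | rewrite addn0].
have Lvi i : i != j -> mon_ideal G ('X_[v + U_(i)] : {mpoly K[n]}).
  move=> ij; have [//|uvi] := Qvi' i; case/negP: Nuv; apply/mnm_lepP => i'.
  move/mnm_lepP: uvi => /(_ i'); rewrite mnmDE mnm1E.
  case: eqVneq => [<- _|_]; last by rewrite addn0.
  by rewrite uE !mulmnE mnm1E eq_sym (negPf ij).
have [IJv|NIJv] := pselect (mon_ideal H ('X_[v] : {mpoly K[n]})).
  have /memIJ[l [c [Mc cv]]] := IJv.
  left; apply: (@Ass_mon_ideal_intro _ _ _ _ v) => [i _|m m0]; last first.
    suff -> : m = 0%MM by rewrite addm0.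
    by apply/mnmP => i; rewrite m0 // mnm0E.
  have [->|/Lvi//] := eqVneq i j.
  have [//|uvj] := Qvi' j; apply/memL; exists l, c; split=> //.
    by apply: lepm_trans uvj; apply/mulm_lel/(mixed_sum_le Mc).
  by apply: lepm_trans cv _; apply: lem_addr.
right; exists j, (u j); split=> //.
apply: (@Ass_mon_ideal_intro _ _ _ _ v) => [i /= ij|m m0].
  by have /memL[l [c [Mc _ cv]]] := Lvi i ij; apply/memIJ; exists l, c.
move=> /memIJ[l [c [Mc /mnm_lepP cvm]]]; apply: NIJv; apply/memIJ.
exists l, c; split=> //; apply/mnm_lepP => i.
have [->|/m0 mi] := eqVneq i j; first by rewrite (dis _ _ Mc).
by move: (cvm i); rewrite mnmDE mi addn0.
Qed.
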